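(* Let $(K_n,P_n)_{n\ge 1}$ be a scaling with $\theta_n=(K_n,P_n)$ such that $\lim_{n\to\infty}q(\theta_n)=1$, and let $(p_n)_{n\ge1}$ be a sequence in $[0,1]$ with $p_n\sim 1-q(\theta_n)$. Then $$\frac{\mathbb{E}[T_n(\theta_n)]}{\mathbb{E}[T_n(p_n)]}\sim 1+\frac{P_n}{K_n^3}\qquad (n\to\infty).$$
   Context: Random key graph: for positive integers $K\le P$ write $\theta=(K,P)$, and let $K_1(\theta),\dots,K_n(\theta)$ be i.i.d. random subsets, each uniformly distributed over the $K$-element subsets of a fixed set of $P$ keys. The random key graph $\mathbb{K}(n;\theta)$ has vertex set $\{1,\dots,n\}$, and distinct nodes $i,j$ are adjacent iff $K_i(\theta)\cap K_j(\theta)\neq\emptyset$. $T_n(\theta)$ denotes the number of (unlabelled) triangles in $\mathbb{K}(n;\theta)$. For $p\in[0,1]$, $\mathbb{G}(n;p)$ is the Erdős–Rényi graph on $\{1,\dots,n\}$ with (independent) edge probability $p$, and $T_n(p)$ is the number of (unlabelled) triangles in $\mathbb{G}(n;p)$. Define $q(\theta)=0$ if $P<2K$ and $q(\theta)=\binom{P-K}{K}/\binom{P}{K}$ if $2K\le P$. A scaling is a pair of sequences $K,P$ of positive integers, with values denoted $K_n,P_n$ ($n=1,2,\dots$), such that $K_n\le P_n$ for all $n=2,3,\dots$. The notation $x_n\sim y_n$ means $\lim_{n\to\infty}x_n/y_n=1$. *)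

(* Defs.v *)
From mathcomp Require Import all_boot all_order all_algebra.
From mathcomp Require Import all_classical all_reals all_analysis.

Set Implicit Arguments.
Unset Strict Implicit.
Unset Printing Implicit Defensive.
Import Order.TTheory GRing.Theory Num.Theory.
Import numFieldNormedType.Exports.
Local Open Scope ring_scope.

(* Laws on a finite type are given by their probability mass functions. *)

Definition expect (R : realType) (T : finType) (mu : T -> R) (X : T -> R) : R :=
  \sum_(w : T) mu w * X w.

Definition uniform_law (R : realType) (T : finType) (S : {set T}) (x : T) : R :=
  (x \in S)%:R / #|S|%:R.

Definition iid_law (R : realType) (T : finType) (n : nat) (mu : T -> R)
    (k : {ffun 'I_n -> T}) : R :=
  \prod_(i < n) mu (k i).

(* Graphs on 'I_n are given by their adjacency relation, which is irreflexive
   and symmetric in both models below. An unlabelled triangle is a 3-element set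
   of pairwise adjacent vertices. *)
Definition triangles (n : nat) (adj : rel 'I_n) : nat :=
  #|[set t : {set 'I_n} | (#|t| == 3%N) &&
      [forall i in t, forall j in t, (i != j) ==> adj i j]]|.

Definition key_law (R : realType) (n K P : nat) :
    {ffun 'I_n -> {set 'I_P}} -> R :=
  iid_law (uniform_law R [set A : {set 'I_P} | #|A| == K]).

Definition key_adj (n P : nat) (k : {ffun 'I_n -> {set 'I_P}}) : rel 'I_n :=
  [rel i j | (i != j) && ~~ [disjoint k i & k j]].

Definition expected_triangles_key (R : realType) (n K P : nat) : R :=
  expect (@key_law R n K P) (fun k => (triangles (key_adj k))%:R).

(* The sample point is the set of edges, a set of unordered pairs; each pair is
   present with probability p, independently of the others. *)
Definition vertex_pairs (n : nat) : {set {set 'I_n}} :=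
  [set e : {set 'I_n} | #|e| == 2%N].

Definition er_law (R : realType) (n : nat) (p : R) (E : {set {set 'I_n}}) : R :=
  if E \subset vertex_pairs n then
    \prod_(e in vertex_pairs n) (if e \in E then p else 1 - p)
  else 0.

Definition er_adj (n : nat) (E : {set {set 'I_n}}) : rel 'I_n :=
  [rel i j | (i != j) && ([set i; j] \in E)].

Definition expected_triangles_er (R : realType) (n : nat) (p : R) : R :=
  expect (@er_law R n p) (fun E => (triangles (er_adj E))%:R).

Definition q_key (R : realType) (K P : nat) : R :=
  if (P < 2 * K)%N then 0 else 'C(P - K, K)%:R / 'C(P, K)%:R.

(* Only the values at n >= 1 are meaningful: the sequences start at n = 1, and
   K n <= P n is required from n = 2 on. *)
Definition scaling (K P : nat -> nat) : Prop :=
  (forall n, (1 <= n)%N -> (0 < K n)%N /\ (0 < P n)%N) /\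
  (forall n, (2 <= n)%N -> (K n <= P n)%N).

(* Division by 0 yields 0, so this limit forces y n != 0 eventually. *)
Definition asymp_equiv (R : realType) (x y : nat -> R) : Prop :=
  ((fun n => x n / y n) @ \oo --> (1 : R))%classic.

(* Main.v *)
(* Both expectations are binom(n,3) times the probability of one given triangle:
   p^3 in the Erdos-Renyi graph and (1-q)^3 + q (q^2 - r) in the random key graph,
   with r = binom(P-2K,K) / binom(P,K). Writing the binomial ratios as products,
   1 - q = 1 - prod_(i<K) (1 - K/(P-i)) and
   1 - r/q^2 = 1 - prod_(i<K) (1 - (K/(P-K-i))^2), which are asymptotic to
   t = K^2/P and K^3/P^2 as soon as t -> 0, and q -> 1 forces t -> 0. Hence
   q (q^2 - r) / (1-q)^3 = c P/K^3 with c -> 1, and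
   (1 + c y) / (1 + y) = 1 + (c-1) y/(1+y) -> 1 whatever y = P/K^3 >= 0 does. *)
Require Import Defs.
From mathcomp Require Import all_boot all_order all_algebra.
From mathcomp Require Import all_classical all_reals all_analysis.
From mathcomp Require Import ring lra zify.
Import Order.TTheory GRing.Theory Num.Theory.
Import numFieldNormedType.Exports.
Local Open Scope ring_scope.

(** * Linearity of expectation and the Erdős-Rényi triangle count *)

Lemma expect_triangles (R : realType) (T : finType) (mu : T -> R) (n : nat)
    (adj : T -> rel 'I_n) :
  expect mu (fun w => (triangles (adj w))%:R) =
  \sum_(t : {set 'I_n} | #|t| == 3%N) expect mu (fun w =>
    ([forall i in t, forall j in t, (i != j) ==> adj w i j] : bool)%:R).
Proof.
rewrite /expect exchange_big /=; apply: eq_bigr => w _.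
rewrite -mulr_sumr /triangles -sum1dep_card natr_sum; congr (_ * _).
rewrite [LHS]big_mkcondr /=; apply: eq_bigr => t _.
by case: ifP.
Qed.

(** Giving weight 0 to a non-pair present in [E] absorbs the support condition, so the law becomes
    one product over all subsets, the shape that distributivity of product over sum requires. *)
Lemma er_law_prod (R : realType) (n : nat) (p : R) (E : {set {set 'I_n}}) :
  er_law p E = \prod_e (if e \in E then if e \in vertex_pairs n then p else 0
                        else if e \in vertex_pairs n then 1 - p else 1).
Proof.
rewrite /er_law; case: ifPn => [/fintype.subsetP EV|/fintype.subsetPn[e eE eV]].
  rewrite big_mkcond /=; apply: eq_bigr => e _.
  by have [/EV ->|] := boolP (e \in E).
by rewrite (bigD1 e) //= eE (negbTE eV) mul0r.
Qed.

(** Distribute the product of all [F e + G e]: [F] weighs [e] present, [G] weighs [e] absent and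
    vanishes on [S], so only the [E] containing [S] survive. Each factor equals p on [S] and 1
    elsewhere. *)
Lemma er_law_superset (R : realType) (n : nat) (p : R) (S : {set {set 'I_n}}) :
  S \subset vertex_pairs n ->
  expect (@er_law R n p) (fun E => (S \subset E)%:R) = p ^+ #|S|.
Proof.
move=> /fintype.subsetP SV.
pose F (e : {set 'I_n}) := if e \in vertex_pairs n then p else 0.
pose G e := (if e \in vertex_pairs n then 1 - p else 1) * (e \notin S)%:R.
have -> : p ^+ #|S| = \prod_e (F e + G e).
  rewrite -prodr_const big_mkcond; apply: eq_bigr => e _; rewrite /F /G.
  have [/SV ->|_] := boolP (e \in S); first by rewrite mulr0 addr0.
  by rewrite mulr1; case: ifP => _; rewrite ?add0r // addrC subrK.
rewrite bigA_distr /expect; apply: eq_bigr => E _.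
have -> : (S \subset E)%:R = \prod_e (if e \in E then 1 else (e \notin S)%:R) :> R.
  case: (boolP (S \subset E)) => [/fintype.subsetP SE|/fintype.subsetPn[e eS eE]].
    rewrite big1 // => e _; case: ifPn => // eE.
    by have [/SE|//] := boolP (e \in S); rewrite (negbTE eE).
  by rewrite (bigD1 e) //= (negbTE eE) eS mul0r.
rewrite er_law_prod -big_split; apply: eq_bigr => e _ /=.
by rewrite /F /G; case: (e \in E); rewrite ?mulr1.
Qed.

Lemma er_clique (n : nat) (E : {set {set 'I_n}}) (t : {set 'I_n}) :
  [forall i in t, forall j in t, (i != j) ==> er_adj E i j] =
  ([set e : {set 'I_n} | e \subset t & #|e| == 2%N] \subset E).
Proof.
apply/idP/fintype.subsetP => [H e|H].
  rewrite inE => /andP[/fintype.subsetP et /cards2P[i [j [ij ee]]]]; subst e.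
  have it : i \in t by apply: et; rewrite !inE eqxx.
  have jt : j \in t by apply: et; rewrite !inE eqxx orbT.
  by have /'forall_implyP/(_ i it)/'forall_implyP/(_ j jt)/implyP/(_ ij)/andP[] := H.
apply/'forall_implyP => i it; apply/'forall_implyP => j jt; apply/implyP => ij.
rewrite /er_adj /= ij /=; apply: H; rewrite inE cards2 ij eqxx andbT.
by apply/fintype.subsetP => x /[!inE] /orP[] /eqP ->.
Qed.

Lemma expected_triangles_erE (R : realType) (n : nat) (p : R) :
  expected_triangles_er n p = 'C(n, 3)%:R * p ^+ 3.
Proof.
rewrite /expected_triangles_er expect_triangles.
transitivity (\sum_(t : {set 'I_n} | #|t| == 3%N) p ^+ 3).
  apply: eq_bigr => t /eqP t3.
  transitivity (expect (@er_law R n p) (fun E =>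
      ([set e : {set 'I_n} | e \subset t & #|e| == 2%N] \subset E)%:R)).
    by apply: eq_bigr => E _; rewrite er_clique.
  (* The exponent is the number of pairs in a 3-set, binom(3,2) = 3. *)
  rewrite er_law_superset ?cards_draws ?t3 //.
  by apply/fintype.subsetP => e; rewrite !inE => /andP[].
by rewrite sumr_const -cardsE card_draws card_ord -[LHS]mulr_natl.
Qed.

(** * The triangle count in the random key graph *)

(** The joint mass of three distinct coordinates factorises because each remaining coordinate sums
    to 1; [f] is then expanded over point indicators. *)
Lemma expect_iid3 (R : realType) (T : finType) (n : nat) (mu : T -> R)
    (a b c : 'I_n) (f : T -> T -> T -> R) :
  \sum_x mu x = 1 -> a != b -> a != c -> b != c ->
  expect (@iid_law R T n mu) (fun k => f (k a) (k b) (k c)) =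
  expect mu (fun x => expect mu (fun y => expect mu (f x y))).
Proof.
move=> mu1; rewrite eq_sym => /negbTE ba; rewrite eq_sym => /negbTE ca.
rewrite eq_sym => /negbTE cb.
have joint x y z : \sum_(k : {ffun 'I_n -> T}) iid_law mu k *
    ((k a == x)%:R * (k b == y)%:R * (k c == z)%:R) = mu x * mu y * mu z.
  pose g i w : R := if i == a then (w == x)%:R else if i == b then (w == y)%:R
    else if i == c then (w == z)%:R else 1.
  transitivity (\sum_(k : {ffun 'I_n -> T}) \prod_i (mu (k i) * g i (k i))).
    apply: eq_bigr => k _; rewrite big_split; congr (_ * _).
    rewrite (bigD1 a) //= (bigD1 b) ?ba //= (bigD1 c) ?ca ?cb //=.
    rewrite big1 => [|i /andP[/andP[/negbTE ia /negbTE ib] /negbTE ic]].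
      by rewrite mulr1 mulrA /g !eqxx ba ca cb.
    by rewrite /g ia ib ic.
  (* A sum over all functions of a product over coordinates is the product of the coordinatewise
     sums. *)
  rewrite -(bigA_distr_bigA (fun i w => mu w * g i w)).
  have pick w : \sum_v mu v * (v == w)%:R = mu w.
    rewrite (bigD1 w) //= eqxx mulr1 big1 ?addr0 // => v /negbTE ->.
    by rewrite mulr0.
  rewrite (bigD1 a) //= (bigD1 b) ?ba //= (bigD1 c) ?ca ?cb //=.
  rewrite [X in _ * (_ * (_ * X))]big1 => [|i /andP[/andP[/negbTE ia /negbTE ib] /negbTE ic]].
    by rewrite mulr1 mulrA /g !eqxx ba ca cb !pick.
  by rewrite /g ia ib ic; under eq_bigr do rewrite mulr1.
rewrite /expect.
transitivity (\sum_(k : {ffun 'I_n -> T}) \sum_x \sum_y \sum_z f x y z *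
    (iid_law mu k * ((k a == x)%:R * (k b == y)%:R * (k c == z)%:R))).
  apply: eq_bigr => k _.
  rewrite (bigD1 (k a)) //= [X in _ + X]big1 ?addr0; last first.
    move=> x /negbTE xa; rewrite big1 // => y _; rewrite big1 // => z _.
    by rewrite (eq_sym (k a)) xa !mul0r !mulr0.
  rewrite (bigD1 (k b)) //= [X in _ + X]big1 ?addr0; last first.
    move=> y /negbTE yb; rewrite big1 // => z _.
    by rewrite (eq_sym (k b)) yb mulr0 mul0r !mulr0.
  rewrite (bigD1 (k c)) //= [X in _ + X]big1 ?addr0; last first.
    by move=> z /negbTE zc; rewrite (eq_sym (k c)) zc !mulr0.
  by rewrite !eqxx !mulr1 mulrC.
rewrite exchange_big; apply: eq_bigr => x _ /=.
rewrite exchange_big mulr_sumr; apply: eq_bigr => y _ /=.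
rewrite exchange_big !mulr_sumr; apply: eq_bigr => z _ /=.
by rewrite -mulr_sumr joint; ring.
Qed.

Lemma sum_uniform_law (R : realType) (T : finType) (S : {set T}) :
  (0 < #|S|)%N -> \sum_x uniform_law R S x = 1.
Proof.
move=> S0; rewrite /uniform_law -mulr_suml -natr_sum -big_mkcond /= sum1_card.
by rewrite divff // pnatr_eq0 -lt0n.
Qed.

(** The [K]-sets disjoint from [B] are the [K]-subsets of its complement. *)
Lemma uniform_law_avoid (R : realType) (T : finType) (K : nat) (B : {set T}) :
  expect (uniform_law R [set A : {set T} | #|A| == K])
    (fun A => [disjoint B & A]%:R) =
  'C(#|T| - #|B|, K)%:R / 'C(#|T|, K)%:R.
Proof.
rewrite /expect /uniform_law card_draws.
under eq_bigr do rewrite mulrAC -natrM mulnb.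
rewrite -mulr_suml -natr_sum -big_mkcond /= sum1dep_card.
have -> : (#|T| - #|B|)%N = #|~: B| by rewrite -(cardsC B) addKn.
rewrite -cards_draws; congr (_%:R / _).
apply: eq_card => A; rewrite !inE andbC; congr (_ && _).
by rewrite disjoint_sym finset.disjoints_subset.
Qed.

(* The probability that three independent key rings pairwise intersect, by
   inclusion-exclusion over the three pairs: two disjointness events are
   independent, and all three have probability [q r]. *)
Lemma expect_key_triangle (R : realType) (T : finType) (K : nat) :
  (K <= #|T|)%N ->
  let mu := uniform_law R [set A : {set T} | #|A| == K] in
  let q := 'C(#|T| - K, K)%:R / 'C(#|T|, K)%:R in
  let r := 'C(#|T| - 2 * K, K)%:R / 'C(#|T|, K)%:R in
  expect mu (fun A => expect mu (fun B => expect mu (fun C =>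
    [&& ~~ [disjoint A & B], ~~ [disjoint A & C] & ~~ [disjoint B & C]]%:R)))
  = (1 - q) ^+ 3 + q * (q ^+ 2 - r).
Proof.
move=> KT mu q r.
have mu1 : \sum_A mu A = 1 by rewrite sum_uniform_law // card_draws bin_gt0.
have mu0 (A : {set T}) : #|A| != K -> mu A = 0.
  by move=> AK; rewrite /mu /uniform_law inE (negbTE AK) mul0r.
pose d (A B : {set T}) : R := [disjoint A & B]%:R.
have dC A B : d A B = d B A by rewrite /d disjoint_sym.
have sq (A : {set T}) : #|A| = K -> \sum_B mu B * d A B = q.
  by move=> AK; have := uniform_law_avoid R T K A; rewrite AK.
pose s A B := \sum_C mu C * (d A C * d B C).
(* If [A] and [B] are disjoint, avoiding both means avoiding a union of size [2 * K]; otherwise both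
   sides vanish. *)
have sr (A B : {set T}) : #|A| = K -> #|B| = K -> d A B * s A B = d A B * r.
  move=> AK BK; rewrite /d; have [AB|] := boolP [disjoint A & B]; last by rewrite !mul0r.
  rewrite !mul1r /r mul2n -addnn -{1}AK -BK -cardsUI.
  move: (AB); rewrite -finset.setI_eq0 => /eqP ->; rewrite cards0 addn0.
  have := uniform_law_avoid R T K (A :|: B); rewrite BK => <-.
  apply: eq_bigr => C _; rewrite /d -natrM mulnb.
  by rewrite !finset.disjoints_subset finset.subUset.
(* Summing over [B] first, with [C] fixed, yields one factor q; the sum over [C] yields the
   other. *)
have ss (A : {set T}) : #|A| = K -> \sum_B mu B * s A B = q ^+ 2.
  move=> AK; rewrite /s.
  under eq_bigr do rewrite mulr_sumr.
  rewrite exchange_big /= expr2 -{1}(sq A AK) mulr_suml.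
  apply: eq_bigr => C _; have [CK|CK] := eqVneq #|C| K; last first.
    by rewrite (mu0 _ CK) !mul0r big1 // => B _; rewrite mul0r mulr0.
  rewrite -(sq C CK) mulr_sumr; apply: eq_bigr => B _.
  by rewrite (dC B C); ring.
rewrite /expect.
transitivity (\sum_A mu A * ((1 - q) ^+ 3 + q * (q ^+ 2 - r))); last first.
  by rewrite -mulr_suml mu1 mul1r.
apply: eq_bigr => A _; have [AK|AK] := eqVneq #|A| K; last by rewrite mu0 // !mul0r.
congr (_ * _).
(* Integrating over [C] leaves (1 - d)(1 - 2q + s) with d = [d A B] and s = [s A B]; by [sr], the
   product d s may be replaced by d r. *)
transitivity (\sum_B ((1 - 2 * q) * mu B - (1 - 2 * q) * (mu B * d A B) + mu B * s A B
   - r * (mu B * d A B))).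
  apply: eq_bigr => B _; have [BK|BK] := eqVneq #|B| K; last first.
    by rewrite mu0 //; ring.
  transitivity (mu B * ((1 - d A B) * \sum_C (mu C - mu C * d A C - mu C * d B C
      + mu C * (d A C * d B C)))).
    congr (_ * _); rewrite mulr_sumr; apply: eq_bigr => C _; rewrite /d.
    case: [disjoint A & B]; case: [disjoint A & C]; case: [disjoint B & C] => /=; ring.
  rewrite big_split /= !sumrB mu1 !sq // -/(s A B).
  have := sr A B AK BK => /(congr1 ( *%R (mu B))).
  set x := s A B; set y := d A B => E.
  transitivity (mu B * (1 - y) * (1 - 2 * q) + mu B * x - mu B * (y * x)); first by ring.
  by rewrite E; ring.
rewrite sumrB big_split /= sumrB -!mulr_sumr mu1 sq // ss //.
by ring.
Qed.

(** When P < 2K, binom(P-K,K) is already 0, so both branches of [q_key] agree with one formula. *)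
Lemma q_keyE (R : realType) (K P : nat) : (K <= P)%N ->
  q_key R K P = 'C(P - K, K)%:R / 'C(P, K)%:R.
Proof.
move=> KP; rewrite /q_key; case: ltnP => // PK.
by rewrite bin_small ?mul0r // ltn_subLR // addnn -mul2n.
Qed.

Lemma cards3E (T : finType) (t : {set T}) : #|t| = 3%N ->
  exists a b c, [/\ t = [set a; b; c], a != b, a != c & b != c].
Proof.
move=> t3; have [a at_] : exists a, a \in t by apply/card_gt0P; rewrite t3.
have : #|t :\ a| == 2%N by move: t3; rewrite (cardsD1 a) at_ => /eqP.
case/cards2P => b [c [bc E]]; exists a, b, c.
have : b \in t :\ a by rewrite E !inE eqxx.
have : c \in t :\ a by rewrite E !inE eqxx orbT.
rewrite !inE => /andP[ca _] /andP[ba _].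
by split; rewrite // 1?eq_sym // -finset.setUA -E finset.setD1K.
Qed.

Lemma key_triangle (n P : nat) (k : {ffun 'I_n -> {set 'I_P}}) (a b c : 'I_n) :
  a != b -> a != c -> b != c ->
  [forall i in [set a; b; c], forall j in [set a; b; c],
    (i != j) ==> key_adj k i j] =
  [&& ~~ [disjoint k a & k b], ~~ [disjoint k a & k c] & ~~ [disjoint k b & k c]].
Proof.
move=> ab ac bc; apply/idP/and3P => [H|[kab kac kbc]].
  have {}H i j : i \in [set a; b; c] -> j \in [set a; b; c] -> i != j ->
      ~~ [disjoint k i & k j].
    move=> it jt ij.
    by have /'forall_implyP/(_ i it)/'forall_implyP/(_ j jt)/implyP/(_ ij)/andP[] := H.
  by split; apply: H; rewrite // !inE eqxx ?orbT.
apply/'forall_implyP => i it; apply/'forall_implyP => j jt; apply/implyP => ij.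
rewrite /key_adj /= ij /=.
move: it jt ij; rewrite !inE => /orP[/orP[]|] /eqP -> /orP[/orP[]|] /eqP ->;
  by rewrite ?eqxx // disjoint_sym.
Qed.

Lemma expected_triangles_keyE (R : realType) (n K P : nat) : (K <= P)%N ->
  let q := q_key R K P in
  expected_triangles_key R n K P =
  'C(n, 3)%:R * ((1 - q) ^+ 3 + q * (q ^+ 2 - 'C(P - 2 * K, K)%:R / 'C(P, K)%:R)).
Proof.
move=> KP /=; rewrite q_keyE // /expected_triangles_key expect_triangles.
set beta := (X in _ = _ * X).
transitivity (\sum_(t : {set 'I_n} | #|t| == 3%N) beta).
  apply: eq_bigr => t /eqP /cards3E[a [b [c [-> ab ac bc]]]].
  pose f (A B C : {set 'I_P}) : R :=
    [&& ~~ [disjoint A & B], ~~ [disjoint A & C] & ~~ [disjoint B & C]]%:R.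
  transitivity (expect (@key_law R n K P) (fun k => f (k a) (k b) (k c))).
    by apply: eq_bigr => k _; rewrite key_triangle.
  rewrite /key_law expect_iid3 //; last first.
    by rewrite sum_uniform_law // card_draws bin_gt0 card_ord.
  by rewrite expect_key_triangle ?card_ord.
by rewrite sumr_const -cardsE card_draws card_ord -[LHS]mulr_natl.
Qed.

(** * Product formulas and bounds for the binomial ratios *)

(** Bernoulli-type bounds: the product is at least 1 - kb and at most 1/(1 + ka). The induction for
    the latter rests on (1 + (m+1)a)(1 - a) <= 1 + ma. *)
Lemma prodr_compl_bounds (R : realFieldType) (k : nat) (x : nat -> R) (a b : R) :
  0 <= a -> b <= 1 -> (forall i, (i < k)%N -> a <= x i <= b) ->
  k%:R * a / (1 + k%:R * a) <= 1 - \prod_(i < k) (1 - x i) <= k%:R * b.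
Proof.
move=> a0 b1.
suff H : (forall i, (i < k)%N -> a <= x i <= b) ->
    0 <= \prod_(i < k) (1 - x i) <= 1 /\
    (1 + k%:R * a) * \prod_(i < k) (1 - x i) <= 1 /\
    1 - k%:R * b <= \prod_(i < k) (1 - x i).
  move=> /H[] _ [H1 H2].
  have ka : 0 <= k%:R * a by rewrite mulr_ge0.
  apply/andP; split; last lra.
  rewrite ler_pdivrMr; last lra.
  by rewrite mulrC; lra.
elim: k => [|k IH] hx; first by rewrite big_ord0; lra.
have [//|/andP[p0 p1] [H1 H2]] := IH; first by move=> i ik; apply: hx; rewrite ltnS ltnW.
have /andP[ax xb] := hx k (ltnSn k).
rewrite big_ord_recr /=; set q := \prod_(i < k) _ in p0 p1 H1 H2 *.
have k0 : 0 <= k%:R :> R by [].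
rewrite -natr1; set m : R := k%:R in k0 H1 H2 *.
have ma : 0 <= m * a by rewrite mulr_ge0.
have qx : 0 <= q * (1 - x k) <= q.
  rewrite mulr_ge0 ?ler_piMr //; lra.
split; first by lra.
split.
  apply: (@le_trans _ _ ((1 + m * a) * q)); last by [].
  rewrite mulrA [_ * q * _]mulrAC ler_wpM2r //.
  have : (1 + (m + 1) * a) * (1 - x k) <= (1 + (m + 1) * a) * (1 - a).
    by rewrite ler_wpM2l; nra.
  by nra.
by nra.
Qed.

(** Multiplying both binomials by K! gives falling factorials, whose i-th factors have ratio
    (P-m-i)/(P-i). *)
Lemma bin_ratio_prod (R : realFieldType) (P K m : nat) : (m + K <= P)%N ->
  'C(P - m, K)%:R / 'C(P, K)%:R =
  \prod_(i < K) (1 - m%:R / (P%:R - i%:R)) :> R.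
Proof.
move=> mKP.
have f0 : K`!%:R != 0 :> R by rewrite pnatr_eq0 -lt0n fact_gt0.
rewrite -(mulfK f0 'C(P - m, K)%:R) -[X in X / _ / _]natrM bin_ffact.
rewrite -mulrA -invfM -natrM mulnC bin_ffact !ffact_prod !natr_prod -prodf_div.
apply: eq_bigr => i _.
have iP : (i + m < P)%N by have := ltn_ord i; lia.
rewrite -subnDA !natrB; [|lia..].
have : P%:R - i%:R != 0 :> R by rewrite -natrB ?pnatr_eq0; lia.
by rewrite natrD => ?; field.
Qed.

(** Every factor has K/(P-i) >= K/P, and K * (K/P) = t. No smallness of t is assumed, so this bound
    can serve to deduce t -> 0 from q -> 1. *)
Lemma q_key_lower (R : realType) (K P : nat) : (0 < K)%N -> (2 * K <= P)%N ->
  let t := K%:R ^+ 2 / P%:R : R in is_true (t / (1 + t) <= 1 - q_key R K P).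
Proof.
move=> K0 KP t; rewrite q_keyE; last by lia.
rewrite bin_ratio_prod; last by lia.
have K0' : 0 < K%:R :> R by rewrite ltr0n.
have KP' : 2 * K%:R <= P%:R :> R by rewrite -natrM ler_nat.
(* The upper bound is discarded, so the crude choice b = 1 is enough. *)
have /andP[+ _] : (K%:R : R) * (K%:R / P%:R) / (1 + K%:R * (K%:R / P%:R)) <=
    1 - \prod_(i < K) (1 - K%:R / (P%:R - i%:R)) <= (K%:R * 1 : R).
  apply: (@prodr_compl_bounds R K (fun i => K%:R / (P%:R - i%:R))) => //.
  move=> i iK; have iK' : i%:R + 1 <= K%:R :> R by rewrite natr1 ler_nat.
  have i0 : 0 <= i%:R :> R by [].
  apply/andP; split; first by rewrite ler_wpM2l // lef_pV2 ?posrE; lra.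
  by rewrite ler_pdivrMr; lra.
by have -> : K%:R * (K%:R / P%:R) = t by rewrite /t expr2 mulrA.
Qed.

(** Both pairs of bounds come from [prodr_compl_bounds]; the errors are then expressed through t
    alone, using k/P <= t, so that t -> 0 squeezes both quotients to 1. *)
Lemma key_estimates (R : realType) (K P : nat) : (0 < K)%N ->
  let k := K%:R : R in let pp := P%:R : R in
  let t := k ^+ 2 / pp in let q := q_key R K P in
  let r := 'C(P - 2 * K, K)%:R / 'C(P, K)%:R in
  t < 1 / 2 -> (0 < P)%N ->
  (1 + t)^-1 <= (1 - q) / t <= (1 - t)^-1 /\
  (1 + t)^-1 <= (1 - r / q ^+ 2) / (k ^+ 3 / pp ^+ 2) <= (1 - 2 * t)^-2.
Proof.
move=> K0 k pp t q r t2 P0.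
have k1 : 1 <= k by rewrite /k ler1n.
have pp0 : 0 < pp by rewrite ltr0n.
(* P > 2K^2 forces P >= 3K, with equality possible at K = 1; this validates the product formula for
   r and gives k/(P-2k) <= 1. *)
have KKP : (2 * (K * K) < P)%N.
  move: t2; rewrite /t ltr_pdivrMr // /k /pp -(ltr_nat R) !natrM; lra.
have KP : (3 * K <= P)%N by nia.
have KP' : 3 * k <= pp by rewrite -natrM ler_nat.
have t0 : 0 < t by rewrite /t divr_gt0 // exprn_gt0; lra.
have kpt : k / pp <= t by rewrite /t ler_wpM2r ?invr_ge0 ?expr2 ?ler_peMr; lra.
have tE : t * pp = k ^+ 2 by rewrite /t; field; lra.
have kp : k / pp * pp = k by field; lra.
have iK i : (i < K)%N -> 0 <= i%:R :> R /\ i%:R + 1 <= k by rewrite natr1 ler_nat.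
split.
  have := @q_key_lower R K P K0 ltac:(lia); rewrite -/k -/pp -/t -/q => ql.
  (* The lower bound being known, a = 0 suffices; b = k/(P-k) since i < K. *)
  have qu : 1 - q <= k * (k / (pp - k)).
    rewrite /q q_keyE; last by lia.
    rewrite bin_ratio_prod; last by lia.
    suff : k * 0 / (1 + k * 0) <= 1 - \prod_(i < K) (1 - k / (pp - i%:R)) <=
        k * (k / (pp - k)) by case/andP.
    apply: (@prodr_compl_bounds R K (fun i => k / (pp - i%:R))) => //.
      by rewrite ler_pdivrMr; lra.
    move=> i /iK[i0 i1].
    rewrite divr_ge0 /= ?ler_wpM2l ?lef_pV2 ?posrE; lra.
  rewrite ler_pdivlMr // ler_pdivrMr // [_ * t]mulrC ql /=.
  apply: (le_trans qu).
  (* The bound equals t/(1 - k/P), and k/P <= t. *)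
  rewrite mulrA -expr2 -tE -mulrA [X in _ <= X]mulrC ler_wpM2l //; first lra.
  rewrite -[pp / _]invf_div lef_pV2 ?posrE ?divr_gt0; try lra.
  by rewrite mulrBl divff ?gt_eqF //; lra.
set s := k ^+ 3 / pp ^+ 2.
have s0 : 0 < s by rewrite /s divr_gt0 // exprn_gt0; lra.
have sE : k * (k / pp) ^+ 2 = s by rewrite /s; field; lra.
have st : s <= t.
  rewrite -sE; have -> : t = k * (k / pp) by rewrite /t; field; lra.
  rewrite ler_wpM2l ?expr2 ?ler_piMr ?divr_ge0 ?ler_pdivrMr; lra.
(* Factorwise, (P-2k-i)(P-i) = (P-k-i)^2 - k^2. *)
have rq : r / q ^+ 2 = \prod_(i < K) (1 - (k / (pp - k - i%:R)) ^+ 2).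
  rewrite /r /q q_keyE; last by lia.
  rewrite bin_ratio_prod; last by lia.
  rewrite bin_ratio_prod; last by lia.
  rewrite -prodrXl -prodf_div; apply: eq_bigr => i _.
  have [i0 i1] := iK i (ltn_ord i).
  by rewrite natrM; field; rewrite -/k -/pp; apply/andP; split; lra.
have /andP[wl wu] : s / (1 + s) <= 1 - r / q ^+ 2 <= k * (k / (pp - 2 * k)) ^+ 2.
  rewrite rq -sE.
  apply: (@prodr_compl_bounds R K (fun i => (k / (pp - k - i%:R)) ^+ 2)).
  - exact: sqr_ge0.
  - by rewrite expr_le1 ?divr_ge0 // ?ler_pdivrMr; lra.
  move=> i /iK[i0 i1].
  rewrite !lerXn2r ?nnegrE ?divr_ge0 ?ler_wpM2l ?lef_pV2 ?posrE //; lra.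
rewrite ler_pdivlMr // ler_pdivrMr //; apply/andP; split.
  apply: le_trans wl; rewrite mulrC ler_wpM2l ?lef_pV2 ?posrE; lra.
apply: (le_trans wu).
(* Once s is factored out, k/P <= t again concludes. *)
have -> : k * (k / (pp - 2 * k)) ^+ 2 = ((1 - 2 * (k / pp)) ^+ 2)^-1 * s.
  rewrite /s; field; rewrite -/k -/pp; apply/andP; split; lra.
rewrite ler_wpM2r; [by []|lra|].
rewrite lef_pV2 ?posrE ?exprn_gt0; try lra.
by rewrite lerXn2r ?nnegrE; lra.
Qed.

(** * Passage to the limit *)

(** Since (k^3/P^2) / (k^2/P)^3 = y, the quotient q(q^2 - r)/(1-q)^3 is y times q^3 v/u^3. The right
    side is arranged so that y enters only through y/(1+y). *)
Lemma triangle_ratio_identity (R : realFieldType) (c k pp p q r : R) :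
  c != 0 -> 0 < k -> 0 < pp -> p != 0 -> q != 0 -> 1 - q != 0 ->
  let u := (1 - q) / (k ^+ 2 / pp) in
  let v := (1 - r / q ^+ 2) / (k ^+ 3 / pp ^+ 2) in
  let y := pp / k ^+ 3 in
  c * ((1 - q) ^+ 3 + q * (q ^+ 2 - r)) / (c * p ^+ 3) / (1 + y) =
  (p / (1 - q))^-1 ^+ 3 * (1 + (q ^+ 3 * v * u^-1 ^+ 3 - 1) * (y / (1 + y))).
Proof.
move=> c0 k0 pp0 p0 q0 q1 u v y.
have ky : k ^+ 3 + pp != 0 by rewrite gt_eqF // addr_gt0 ?exprn_gt0.
rewrite /u /v /y; field.
by rewrite c0 p0 q0 q1 ky !gt_eqF.
Qed.

Local Open Scope classical_set_scope.

(** Meant for z = y/(1+y), which need not converge; boundedness replaces the product rule for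
    limits. *)
Lemma cvg0_mul_unit_interval (R : realFieldType) (f z : nat -> R) :
  (forall n, 0 <= z n <= 1) ->
  f @ \oo --> (0 : R) -> (fun n => f n * z n) @ \oo --> (0 : R).
Proof.
move=> hz f0; apply: norm_cvg0.
apply: (@squeeze_cvgr _ _ _ _ (fun=> 0) (fun n => `|f n|)).
- near=> n; have /andP[z0 z1] := hz n.
  by rewrite normr_ge0 normrM (ger0_norm z0) ler_piMr.
- exact: cvg_cst.
- by rewrite -(@normr0 _ R); apply: cvg_norm.
Unshelve. all: by end_near. Qed.

Theorem mainTheorem3 (R : realType) (K P : nat -> nat) (p : nat -> R)
    (hKP : scaling K P)
    (hq : (fun n => q_key R (K n) (P n)) @ \oo --> (1 : R))
    (hp01 : forall n, (1 <= n)%N -> 0 <= p n <= 1)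
    (hp : asymp_equiv p (fun n => 1 - q_key R (K n) (P n))) :
  asymp_equiv
    (fun n => expected_triangles_key R n (K n) (P n) /
              expected_triangles_er n (p n))
    (fun n => 1 + (P n)%:R / (K n)%:R ^+ 3).
Proof.
have [pos le] := hKP.
rewrite /asymp_equiv in hp *.
set q := fun n => q_key R (K n) (P n) in hq hp.
pose t n : R := (K n)%:R ^+ 2 / (P n)%:R.
pose r n : R := 'C(P n - 2 * K n, K n)%:R / 'C(P n, K n)%:R.
pose u n := (1 - q n) / t n.
pose v n := (1 - r n / q n ^+ 2) / ((K n)%:R ^+ 3 / (P n)%:R ^+ 2).
pose y n : R := (P n)%:R / (K n)%:R ^+ 3.
(* From n = 3 on, binom(n,3) is nonzero, so the ratio of expectations is not a division by 0. *)
have near3 : \forall n \near \oo, (3 <= n)%N by exact: nbhs_infty_ge.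
have nearq : \forall n \near \oo, 0 < q n by apply: (cvgr_gt _ hq).
have tpos n : (1 <= n)%N -> 0 < t n.
  by move=> /pos[K0 P0]; rewrite divr_gt0 ?exprn_gt0 ?ltr0n.
(* Positivity of q excludes the branch P < 2K, where [q_key] is 0. *)
have tq n : (1 <= n)%N -> 0 < q n -> t n / (1 + t n) <= 1 - q n.
  move=> /pos[K0 P0] q0; apply: q_key_lower => //.
  by move: q0; rewrite /q /q_key; case: ltnP => // _; rewrite ltxx.
have t0 : t @ \oo --> (0 : R).
  (* The inequality t/(1+t) <= 1-q rearranges to tq <= 1-q. *)
  apply: (@squeeze_cvgr _ _ _ _ (fun=> 0) (fun n => (1 - q n) / q n)).
  - near=> n.
    have n3 : (3 <= n)%N by near: n.
    have q0 : 0 < q n by near: n.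
    have n1 : (1 <= n)%N by apply: leq_trans n3.
    have tn := tpos n n1; rewrite (ltW tn) ler_pdivlMr //=.
    have := tq n n1 q0; rewrite ler_pdivrMr; last lra.
    nra.
  - exact: cvg_cst.
  - rewrite -[0 in X in _ --> X](_ : (1 - 1) / 1 = 0); last by rewrite subrr mul0r.
    apply: cvgM; first by apply: cvgB => //; exact: cvg_cst.
    by apply: cvgV.
have est : \forall n \near \oo,
    (1 + t n)^-1 <= u n <= (1 - t n)^-1 /\
    (1 + t n)^-1 <= v n <= (1 - 2 * t n)^-2.
  near=> n.
  have n3 : (3 <= n)%N by near: n.
  have [K0 P0] := pos n (leq_trans (isT : (1 <= 3)%N) n3).
  apply: key_estimates => //.
  by near: n; apply: (cvgr_lt _ t0); lra.
have lower : (fun n => (1 + t n)^-1) @ \oo --> (1 : R).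
  rewrite -[1 in X in _ --> X](_ : (1 + 0)^-1 = 1); last by rewrite addr0 invr1.
  apply: cvgV; first by rewrite addr0.
  by apply: cvgD => //; exact: cvg_cst.
have u1 : u @ \oo --> (1 : R).
  apply: (@squeeze_cvgr _ _ _ _ _ (fun n => (1 - t n)^-1) _ _ _ lower).
    by apply: filterS est => n [].
  rewrite -[1 in X in _ --> X](_ : (1 - 0)^-1 = 1); last by rewrite subr0 invr1.
  apply: cvgV; first by rewrite subr0.
  by apply: cvgB => //; exact: cvg_cst.
have v1 : v @ \oo --> (1 : R).
  apply: (@squeeze_cvgr _ _ _ _ _ (fun n => (1 - 2 * t n)^-2) _ _ _ lower).
    by apply: filterS est => n [].
  rewrite -[1 in X in _ --> X](_ : ((1 - 2 * 0) ^+ 2)^-1 = 1); last first.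
    by rewrite mulr0 subr0 expr1n invr1.
  apply: cvgV; first by rewrite mulr0 subr0 expr1n.
  apply: (@cvg_comp _ _ _ (fun n => 1 - 2 * t n) (fun x => x ^+ 2)); last exact: exprn_continuous.
  apply: cvgB; first exact: cvg_cst.
  by apply: cvgM => //; exact: cvg_cst.
have cube (f : nat -> R) : f @ \oo --> (1 : R) -> (fun n => f n ^+ 3) @ \oo --> (1 : R).
  move=> f1; rewrite -[1 in X in _ --> X](expr1n _ 3).
  by apply: (@cvg_comp _ _ _ f (fun x => x ^+ 3)); last exact: exprn_continuous.
have inv (f : nat -> R) : f @ \oo --> (1 : R) -> (fun n => (f n)^-1) @ \oo --> (1 : R).
  by move=> f1; rewrite -[1 in X in _ --> X]invr1; apply: cvgV.
have cvgM1 (f g : nat -> R) : f @ \oo --> (1 : R) -> g @ \oo --> (1 : R) ->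
    (fun n => f n * g n) @ \oo --> (1 : R).
  by move=> f1 g1; rewrite -[1 in X in _ --> X](mulr1 1); apply: cvgM.
have main : (fun n => (p n / (1 - q n))^-1 ^+ 3 *
    (1 + (q n ^+ 3 * v n * (u n)^-1 ^+ 3 - 1) * (y n / (1 + y n)))) @ \oo --> (1 : R).
  apply: (cvgM1); first exact/cube/inv.
  rewrite -[1 in X in _ --> X]addr0; apply: cvgD; first exact: cvg_cst.
  apply: cvg0_mul_unit_interval => [n|].
    have y0 : 0 <= y n by rewrite divr_ge0 ?exprn_ge0.
    move: (y n) y0 => z z0.
    by apply/andP; split; [apply: divr_ge0|rewrite ler_pdivrMr]; lra.
  rewrite -[0 in X in _ --> X](subrr 1); apply: cvgB; last exact: cvg_cst.
  exact: (cvgM1 _ _ (cvgM1 _ _ (cube _ hq) v1) (cube _ (inv _ u1))).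
apply: cvg_trans main; apply: near_eq_cvg; near=> n.
have n3 : (3 <= n)%N by near: n.
have n1 : (1 <= n)%N by apply: leq_trans n3.
have [K0 P0] := pos n n1.
have q0 : 0 < q n by near: n.
have tn := tpos n n1.
(* Strict because t > 0; hence dividing by 1-q is legitimate. *)
have q1 : 0 < 1 - q n.
  by apply: lt_le_trans (tq n n1 q0); rewrite divr_gt0 // addr_gt0.
(* A ratio tending to 1 is eventually positive, so p is eventually nonzero and the Erdős-Rényi
   expectation can be divided by. *)
have p0 : 0 < p n / (1 - q n) by near: n; apply: (cvgr_gt _ hp).
rewrite expected_triangles_keyE ?le // ?(leq_trans _ n3) //.
rewrite expected_triangles_erE; symmetry.
apply: triangle_ratio_identity; rewrite ?ltr0n ?gt_eqF //.
  by rewrite ltr0n bin_gt0.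
by move: p0; rewrite pmulr_lgt0 // invr_gt0.
Unshelve. all: by end_near. Qed.
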